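(* Let $G$ be a graph of order $n$. Then (i) $\lambda(G)=n-1$ if and only if $G=K_1$; (ii) $\lambda(G)=n-2$ if and only if $G=P_{n-1}\cup K_1$ or $G=P_3$.
   Context: Graphs are finite, simple (no loops or multiple edges), undirected; $n=|V(G)|$ is the order of $G$ (at least 1). $P_m$ is the path on $m$ vertices, $K_m$ the complete graph on $m$ vertices, and $G\cup H$ is the disjoint union of graphs. Standard zero forcing: a subset $S\subseteq V(G)$ is colored blue and all other vertices white. Standard color change rule: if a blue vertex has exactly one white neighbor, then that white neighbor becomes blue. $S$ is a zero forcing set if repeated application of the rule eventually turns all vertices blue. The zero forcing span $\lambda(G)$ is the number of distinct cardinalities $k$ for which there exist $Z,F\subseteq V(G)$ with $|Z|=|F|=k$ such that $Z$ is a zero forcing set and $F$ is not a zero forcing set.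
   Formalization: Part (ii) is stated for graphs G other than K_2, since λ(K_2)=0=n-2 although K_2 is neither P_1∪K_1 nor P_3; the case G=P_{n-1}∪K_1 is read with n≥2, so that P_{n-1} is a graph. *)

(* Defs.v *)
From mathcomp Require Import all_boot all_order all_algebra.

Set Implicit Arguments.
Unset Strict Implicit.
Unset Printing Implicit Defensive.

Record sgraph := SGraph {
  vertex :> finType;
  edge : rel vertex;
  edge_sym : symmetric edge;
  edge_irrefl : irreflexive edge }.

Definition graph_iso (G H : sgraph) : Prop :=
  exists2 f : G -> H, bijective f & forall x y, edge (f x) (f y) = edge x y.

Section Path.
Variable m : nat.

Definition path_rel : rel 'I_m := fun i j => (i.+1 == j) || (j.+1 == i).

Lemma path_rel_sym : symmetric path_rel.
Proof. by move=> i j; rewrite /path_rel orbC. Qed.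

Lemma path_rel_irrefl : irreflexive path_rel.
Proof. by move=> i; rewrite /path_rel orbb eqn_leq ltnn. Qed.

Definition path_graph : sgraph := SGraph path_rel_sym path_rel_irrefl.

End Path.

Section Complete.
Variable m : nat.

Definition complete_rel : rel 'I_m := fun i j => i != j.

Lemma complete_rel_sym : symmetric complete_rel.
Proof. by move=> i j; rewrite /complete_rel eq_sym. Qed.

Lemma complete_rel_irrefl : irreflexive complete_rel.
Proof. by move=> i; rewrite /complete_rel eqxx. Qed.

Definition complete_graph : sgraph :=
  SGraph complete_rel_sym complete_rel_irrefl.

End Complete.

Section DisjointUnion.
Variables G H : sgraph.

Definition union_rel : rel (G + H)%type := fun x y =>
  match x, y with
  | inl u, inl v => edge u v
  | inr u, inr v => edge u v
  | _, _ => false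
  end.

Lemma union_rel_sym : symmetric union_rel.
Proof. by move=> [u|u] [v|v] //=; apply: edge_sym. Qed.

Lemma union_rel_irrefl : irreflexive union_rel.
Proof. by move=> [u|u] /=; apply: edge_irrefl. Qed.

Definition disjoint_union : sgraph := SGraph union_rel_sym union_rel_irrefl.

End DisjointUnion.

Section ZeroForcing.
Variable G : sgraph.
Implicit Types S Z F : {set G}.

Definition white_neighbors S (v : G) : {set G} :=
  [set w | edge v w & w \notin S].

(* A set of vertices stands for the set of blue vertices. *)
Definition color_change : rel {set G} := fun S S' =>
  [exists v in S, exists w,
    (white_neighbors S v == [set w]) && (S' == w |: S)].

Definition zero_forcing S : bool := connect color_change S [set: G].

(* The possible cardinalities of a vertex set are 0, ..., #|G|. *)
Definition zf_span : nat :=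
  #|[set k : 'I_#|G|.+1 | [exists Z : {set G}, exists F : {set G},
       [&& #|Z| == k, #|F| == k, zero_forcing Z & ~~ zero_forcing F]]]|.

End ZeroForcing.

(* Main.v *)
(**
Let z be the least size of a zero forcing set and f the greatest size of a set
that is not zero forcing. Both properties are monotone in the set, so
zf_span G = f + 1 - z with 1 <= z <= f + 1 <= n, whence
- zf_span G = n - 1 iff z = 1 and f = n - 1;
- zf_span G = n - 2 iff (z = 1 and f = n - 2) or (z = 2 and f = n - 1).
Now f = n - 1 means that some vertex u is isolated; such a u lies in every zero
forcing set, so z = 1 then leaves only K_1, and z = 2 means that the rest of the
graph is forced by one vertex. A single starting vertex can only force an
induced path, since each blue vertex but the last has no white neighbor left.
So z = 1 means that G is a path, and a path of order at least 4 has no failing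
set of size n - 2: its two white vertices would be adjacent to the same blue
vertices.
*)

Require Import Defs.
From mathcomp Require Import all_boot all_order all_algebra.
From mathcomp Require Import zify.

Set Implicit Arguments.
Unset Strict Implicit.
Unset Printing Implicit Defensive.

Import GRing.Theory.
Local Open Scope ring_scope.

(** * Interval counting and graph isomorphisms *)

Lemma card_ord_interval (n z f : nat) : (z <= f.+1 <= n)%N ->
  #|[set k : 'I_n | (z <= k <= f)%N]| = (f.+1 - z)%N.
Proof.
case/andP=> zf fn.
rewrite -sum1dep_card -(big_mkord (fun k => z <= k <= f)%N (fun=> 1%N)).
have sum0 a b : (forall k, a <= k < b -> (z <= k <= f) = false)%N ->
    (\sum_(a <= k < b | z <= k <= f) 1 = 0)%N.
  by move=> H; rewrite big_nat_cond big_pred0 // => k; apply/negP => /andP[/H->].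
have sum1 : (\sum_(z <= k < f.+1 | z <= k <= f) 1 = \sum_(z <= k < f.+1) 1)%N.
  by rewrite big_nat_cond [RHS]big_nat_cond; apply: eq_bigl => k; lia.
rewrite (@big_cat_nat _ _ _ z) ?(leq_trans zf) //= (@big_cat_nat _ _ _ f.+1 z) //=.
by rewrite sum1 !sum0 ?sum_nat_const_nat ?muln1 ?addn0 //; move=> k; lia.
Qed.

Lemma graph_iso_sym (G H : sgraph) : graph_iso G H -> graph_iso H G.
Proof.
case=> f [g fK gK] fE; exists g; first by exists f.
by move=> x y; rewrite -fE !gK.
Qed.

(** Spares an inverse map: an injection of finite sets into one that is no larger is a bijection. *)
Lemma graph_iso_inj (G H : sgraph) (f : G -> H) :
  injective f -> (#|H| <= #|G|)%N ->
  (forall x y, edge (f x) (f y) = edge x y) -> graph_iso G H.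
Proof. by move=> f_inj leHG fE; exists f => //; apply: inj_card_bij. Qed.

Lemma graph_iso_card (G H : sgraph) : graph_iso G H -> #|G| = #|H|.
Proof. by case=> f /bij_eq_card. Qed.

(** * Zero forcing through stalled sets *)

Section Forcing.
Variable G : sgraph.
Implicit Types (S T U : {set G}) (u v w x y : G) (s : seq G).
Local Open Scope nat_scope.

(* A set is zero forcing iff its only stalled superset is the whole graph
   (zero_forcingP): this replaces forcing sequences by an order-theoretic test. *)
Definition stalled T := [forall v in T, forall w, white_neighbors T v != [set w]].

Definition isolated u := [forall v, ~~ edge u v].

Lemma stalledP T :
  reflect (forall v w, v \in T -> white_neighbors T v <> [set w]) (stalled T).
Proof.
apply: (iffP forall_inP) => [H v w vT|H v vT].
  by apply/eqP; move/forallP: (H v vT).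
by apply/forallP => w; apply/eqP/H.
Qed.

Lemma isolatedE u v : isolated u -> (edge u v = false) * (edge v u = false).
Proof. by move/forallP/(_ v)/negbTE => uv; rewrite [edge v u]edge_sym uv. Qed.

(** Induction along a forcing sequence. [P] is valued in [Prop] so that it can assert the existence
    of a path. *)
Lemma color_change_invariant (P : {set G} -> Prop) S T :
  (forall A B, P A -> @color_change G A B -> P B) ->
  connect (@color_change G) S T -> P S -> P T.
Proof.
move=> Pstep /connectP[q].
elim: q S => [|B q IH] S /= => [_ -> //|/andP[SB qB] Tq PS].
exact: IH qB Tq (Pstep _ _ PS SB).
Qed.

Lemma zero_forcingP S :
  reflect (forall T, S \subset T -> stalled T -> T = setT) (zero_forcing S).
Proof.
apply: (iffP idP) => [ZS T ST /stalledP stT|H].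
  apply/eqP; rewrite -subTset.
  (* A stalled [T] traps the process: passing from [A] to the larger [T] only removes white
     neighbors, so a force out of [T] would also be available in [T]. *)
  apply: (color_change_invariant (P := fun B => B \subset T) _ ZS ST).
  move=> A B AT /exists_inP[v vA /existsP[w /andP[/eqP wA /eqP->]]].
  rewrite subUset AT andbT sub1set; apply/negPn/negP => wT.
  apply: (stT v w (subsetP AT _ vA)); apply/eqP; rewrite eqEsubset sub1set.
  have: w \in white_neighbors A v by rewrite wA set11.
  rewrite -wA !inE wT => /andP[-> _]; rewrite /= andbT.
  apply/subsetP => y; rewrite !inE => /andP[-> yT] /=.
  by apply: contra yT; apply: subsetP.
(* A largest set reachable from [S] is stalled, as one more force would enlarge it. *)
have [B SB Bmax] : exists2 B, connect (@color_change G) S B &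
    forall B', connect (@color_change G) S B' -> #|B'| <= #|B|.
  by case: (arg_maxnP (fun B : {set G} => #|B|) (connect0 (@color_change G) S));
    move=> B; exists B.
rewrite /zero_forcing -(H B) //.
  apply: (color_change_invariant (P := fun B : {set G} => S \subset B) _ SB) => //.
  move=> A A' SA /exists_inP[v _ /existsP[w /andP[_ /eqP->]]].
  by rewrite subsetU ?SA ?orbT.
apply/stalledP => v w vB wB.
have wNB : w \notin B.
  by have := set11 w; rewrite -wB inE => /andP[].
suff /Bmax : connect (@color_change G) S (w |: B) by rewrite cardsU1 wNB ltnn.
apply: connect_trans SB _; apply: connect1; apply/exists_inP; exists v => //.
by apply/existsP; exists w; rewrite wB !eqxx.
Qed.

Lemma failedP S :
  reflect (exists T, [/\ S \subset T, stalled T & T != setT]) (~~ zero_forcing S).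
Proof.
apply: (iffP negP) => [H|[T [ST stT /eqP nT]] /zero_forcingP/(_ T ST stT)] //.
case: (pickP (fun T : {set G} => [&& S \subset T, stalled T & T != setT])) => [T|P0].
  by case/and3P; exists T.
case: H; apply/zero_forcingP => T ST stT; apply/eqP.
by move: (P0 T); rewrite ST stT => /negbFE.
Qed.

Lemma zero_forcingS S T : S \subset T -> zero_forcing S -> zero_forcing T.
Proof.
move=> ST /zero_forcingP ZS; apply/zero_forcingP => B TB.
exact/ZS/(subset_trans ST).
Qed.

Lemma zero_forcingT : zero_forcing [set: G].
Proof. exact: connect0. Qed.

Lemma zero_forcing0 : 0 < #|G| -> ~~ zero_forcing (set0 : {set G}).
Proof.
move=> G_gt0; apply/failedP; exists set0; split => //.
  by apply/stalledP => v w; rewrite inE.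
by apply: contraTneq G_gt0 => E; rewrite -cardsT -E cards0.
Qed.

(** * Sizes of forcing and failing sets *)

Definition zf_size k := [exists S : {set G}, (#|S| == k) && zero_forcing S].

Definition failed_size k := [exists S : {set G}, (#|S| == k) && ~~ zero_forcing S].

Lemma zf_sizeS k : k < #|G| -> zf_size k -> zf_size k.+1.
Proof.
move=> kG /existsP[S /andP[/eqP Sk ZS]].
have /set0Pn[x] : ~: S != set0 by rewrite -card_gt0 cardsCs setCK Sk subn_gt0.
rewrite inE => xS; apply/existsP; exists (x |: S).
by rewrite cardsU1 xS Sk eqxx (zero_forcingS (subsetUr _ _)).
Qed.

Lemma failed_size_pred k : failed_size k.+1 -> failed_size k.
Proof.
case/existsP => S /andP[/eqP Sk FS].
have /set0Pn[x xS] : S != set0 by rewrite -card_gt0 Sk.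
apply/existsP; exists (S :\ x); move: (cardsD1 x S); rewrite xS Sk add1n => -[<-].
by rewrite eqxx; apply: contra FS; apply: zero_forcingS; apply: subsetDl.
Qed.

(** Forcing survives adding a vertex and failure survives removing one, so the forcing sizes form a
    final segment, the failing sizes an initial one, and the span counts their overlap. *)
Lemma zf_spanE : 0 < #|G| -> exists z f : nat,
  [/\ 0 < z <= f.+1, f < #|G|, zf_span G = f.+1 - z,
      forall k, zf_size k = (z <= k <= #|G|)
    & forall k, failed_size k = (k <= f)].
Proof.
move=> G_gt0.
have zf_sizeT : zf_size #|G|.
  by apply/existsP; exists setT; rewrite cardsT eqxx zero_forcingT.
have failed_size0 : failed_size 0.
  by apply/existsP; exists set0; rewrite cards0 zero_forcing0.
have failed_ub k : failed_size k -> k <= #|G|.-1.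
  case/existsP => S /andP[/eqP <- FS]; rewrite -ltnS prednK //.
  rewrite ltn_neqAle max_card andbT -cardsT; apply: contra FS => /eqP SG.
  suff -> : S = setT by apply: zero_forcingT.
  by apply/eqP; rewrite eqEcard subsetT SG /=.
have zf_lb : ~~ zf_size 0.
  apply/existsP => -[S /andP[/eqP/cards0_eq-> ZS]].
  by move: (zero_forcing0 G_gt0); rewrite ZS.
have zf_ub k : zf_size k -> k <= #|G|.
  by case/existsP => S /andP[/eqP <- _]; apply: max_card.
(* The first [k] vertices form a set that forces or fails, so the two segments leave no gap; at
   [k = f.+1] this gives [z <= f.+1]. *)
have zf_or_failed k : k <= #|G| -> zf_size k || failed_size k.
  move=> kG; have [s [s_uniq <-]] : exists s : seq G, uniq s /\ size s = k.
    exists (take k (enum G)); rewrite take_uniq ?enum_uniq // size_takel //.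
    by rewrite -cardE.
  have cs : #|[set x in s]| = size s by rewrite cardsE; apply/card_uniqP.
  case ZS: (zero_forcing [set x in s]); apply/orP; [left|right]; apply/existsP;
    by exists [set x in s]; rewrite cs eqxx ZS.
have exZ : exists k, zf_size k by exists #|G|.
have exF : exists k, failed_size k by exists 0.
case: (ex_minnP exZ) => z zP zmin.
case: (ex_maxnP exF failed_ub) => f fP fmax.
have zE k : zf_size k = (z <= k <= #|G|).
  apply/idP/andP => [kP|[zk kG]]; first by rewrite zmin ?zf_ub.
  elim: k zk kG => [|k IH]; first by rewrite leqn0 => /eqP <-.
  rewrite leq_eqVlt => /predU1P[<- //|zk] kG; apply: zf_sizeS => //.
  by apply: IH => //; apply: ltnW.
have fE k : failed_size k = (k <= f).
  apply/idP/idP => [/fmax //|/subKn <-].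
  elim: (f - k) => [|d IH]; first by rewrite subn0.
  have [fd|fd] := leqP f d; first by rewrite (_ : f - d.+1 = 0) //; lia.
  by apply: failed_size_pred; rewrite subnSK.
have f_lt : f < #|G| by have := failed_ub f fP; rewrite -ltnS prednK.
have z_gt0 : 0 < z by rewrite lt0n; apply: contraNneq zf_lb => <-.
have z_le : z <= f.+1.
  by have := zf_or_failed f.+1 f_lt; rewrite fE ltnn orbF zE => /andP[].
exists z, f; split; rewrite ?z_gt0 //.
rewrite /zf_span.
have -> : [set k : 'I_#|G|.+1 | [exists Z : {set G}, exists F : {set G},
       [&& #|Z| == k, #|F| == k, zero_forcing Z & ~~ zero_forcing F]]] =
   [set k : 'I_#|G|.+1 | z <= k <= f].
  apply/setP => k; rewrite !inE; transitivity (zf_size k && failed_size k).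
    apply/existsP/andP => [[Z /existsP[F /and4P[Zk Fk ZZ FF]]]|].
      by split; apply/existsP; [exists Z|exists F]; apply/andP.
    case=> /existsP[Z /andP[Zk ZZ]] /existsP[F /andP[Fk FF]].
    by exists Z; apply/existsP; exists F; apply/and4P.
  by rewrite zE fE; have := ltn_ord k; lia.
by rewrite card_ord_interval // z_le ltnW.
Qed.

(** * Isolated vertices *)

(** The complement of [u] is stalled: its only white vertex has no neighbor. *)
Lemma isolated_failed u S : isolated u -> u \notin S -> ~~ zero_forcing S.
Proof.
move=> isou uS; apply/failedP; exists (~: [set u]); split.
- by rewrite subsetC sub1set inE.
- apply/stalledP => v w vu vw.
  have := set11 w; rewrite -vw !inE negbK => /andP[vw1 /eqP wu].
  by rewrite wu (isolatedE v isou) in vw1.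
- by apply/eqP => /setP/(_ u); rewrite !inE eqxx.
Qed.

(** A neighbor of [u] would be blue with [u] as its only white neighbor. *)
Lemma stalled_setC1 u : stalled (~: [set u]) -> isolated u.
Proof.
move/stalledP=> H; apply/forallP => v; apply/negP => uv.
have vu : v != u by apply: contraTneq uv => ->; rewrite edge_irrefl.
apply: (H v u); rewrite ?inE //; apply/setP => w; rewrite !inE negbK.
by rewrite andb_idl // => /eqP->; rewrite edge_sym.
Qed.

Lemma failed_size_isolated :
  0 < #|G| -> failed_size #|G|.-1 -> exists u, isolated u.
Proof.
move=> G_gt0 /existsP[F /andP[/eqP cF /failedP[T [FT stT nT]]]].
have /cards1P[u uT] : #|~: T| == 1.
  have : 0 < #|~: T| by rewrite card_gt0 -setCT (inj_eq (@setC_inj _)).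
  by have := subset_leq_card FT; have := cardsC T; lia.
by exists u; apply: stalled_setC1; rewrite -uT setCK.
Qed.

(** * Induced paths and forcing from one vertex *)

(** Quantifying over the default [x0] avoids fixing a vertex of [G]; the bounds on [i] and [j] keep
    it from being reached. *)
Definition induced_path s :=
  uniq s /\ forall x0 i j, i < size s -> j < size s ->
    edge (nth x0 s i) (nth x0 s j) = (i.+1 == j) || (j.+1 == i).

(** The end of the path forces the other vertices in order. [U] is empty for a path, and a singleton
    for a path with an isolated vertex. *)
Lemma path_zero_forcing U s x :
  (forall u, u \in U -> isolated u) -> s =i ~: U -> induced_path s ->
  0 < size s -> zero_forcing (nth x s 0 |: U).
Proof.
move=> isoU sE [s_uniq s_edge] s_gt0; apply/zero_forcingP => T.
rewrite subUset sub1set => /andP[s0T UT] /stalledP stT.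
suff sT k : k < size s -> nth x s k \in T.
  apply/setP => y; rewrite inE.
  have [/(subsetP UT)-> //|yU] := boolP (y \in U).
  have ys : y \in s by rewrite sE inE.
  by rewrite -(nth_index x ys) sT // index_mem.
(* All entries up to index [k] are blue, so a white successor would be the only white neighbor of
   entry [k]. *)
elim/ltn_ind: k => -[//|k] IH ks; apply/negPn/negP => kT.
apply: (stT (nth x s k) (nth x s k.+1)); first exact: IH (ltnW ks).
apply/setP => y; rewrite !inE.
have [yU|yU] := boolP (y \in U).
  rewrite (isolatedE _ (isoU y yU)) /=; apply/esym/negbTE.
  by apply: contraNneq kT => <-; apply: (subsetP UT).
have ys : y \in s by rewrite sE inE.
have js : index y s < size s by rewrite index_mem.
have k1s : k < size s by apply: ltnW.
rewrite -{1 2 3}(nth_index x ys) s_edge // nth_uniq // eq_sym.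
have [->|ne] /= := eqVneq (index y s) k.+1; first by rewrite kT.
by apply/andP => -[/eqP jk]; rewrite IH //; lia.
Qed.

Lemma zero_forcing_path U v :
  (forall u, u \in U -> isolated u) -> v \notin U -> zero_forcing (v |: U) ->
  exists2 s, s =i ~: U & induced_path s.
Proof.
move=> isoU vU ZU.
(* The forcing chain is listed from the most recent vertex x backwards. *)
pose I (B : {set G}) := exists x t,
  [/\ forall y, (y \in B) = (y \in U) || (y \in x :: t),
      forall y, y \in x :: t -> y \notin U,
      forall y w, y \in t -> edge y w -> w \in B
    & induced_path (x :: t)].
have [x [t [tE tU _ tP]]] : I setT.
  apply: (color_change_invariant _ ZU) => [A B|]; last first.
    exists v, [::]; split=> //.
    - by move=> y; rewrite !inE orbC.
    - by move=> y; rewrite inE => /eqP->.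
    - by split=> // x0 [|i] [|j] //= _ _; rewrite edge_irrefl.
  move=> [x [t [tE tU tN [t_uniq t_edge]]]].
  case/exists_inP => y yA /existsP[w /andP[/eqP wE /eqP->]].
  have /[!inE] /andP[yw wA] : w \in white_neighbors A y by rewrite wE set11.
  (* Only the newest vertex can force: those in [U] have no neighbor, and those in [t] have no white
     one. *)
  have yx : y = x.
    move: yA; rewrite tE inE => /or3P[/isoU/(isolatedE w)| /eqP // |yt].
      by rewrite yw => -[].
    by rewrite (tN y w yt yw) in wA.
  subst y; have wN y : edge x y -> y \in w |: A.
    move=> xy; rewrite !inE; have [//|yA'] := boolP (y \in A); rewrite ?orbT //.
    have : y \in white_neighbors A x by rewrite inE xy.
    by rewrite wE inE => ->.
  have := wA; rewrite tE negb_or => /andP[wU wt].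
  exists w, (x :: t); split.
  - by move=> y; rewrite !inE tE inE orbCA.
  - by move=> y; rewrite inE => /predU1P[->|/tU].
  - move=> y z; rewrite inE => /predU1P[->|yt yz]; first exact: wN.
    by rewrite inE (tN y z) ?orbT.
  - split; first by rewrite [uniq _]/= -/(uniq (x :: t)) wt.
    (* The new [w] was white, hence is not adjacent to any vertex of [t]; index 0 is the vertex [x]
       that forced it. *)
    have wt_edge x0 j : j < size (x :: t) -> edge w (nth x0 (x :: t) j) = (j == 0).
      case: j => [|j] jt /=; first by rewrite edge_sym.
      apply/negbTE/negP; rewrite edge_sym => /tN; rewrite mem_nth // => /(_ isT).
      exact/negP.
    move=> x0 [|i] [|j] //= it jt; first by rewrite edge_irrefl.
    + by rewrite wt_edge // eqSS eq_sym orbF.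
    + by rewrite edge_sym wt_edge // eqSS eq_sym.
    + exact: t_edge.
exists (x :: t) => // y; rewrite [RHS]inE; have := tE y; rewrite in_setT => /esym.
have [yU _|yU /= ->] // := boolP (y \in U).
by apply/negbTE; apply: contraL yU => /tU.
Qed.

Lemma induced_path_map m (f : 'I_m -> G) :
  injective f -> (forall i j, edge (f i) (f j) = path_rel i j) ->
  induced_path [seq f i | i <- enum 'I_m].
Proof.
move=> f_inj fE; split; first by rewrite map_inj_uniq ?enum_uniq.
rewrite size_map size_enum_ord => x0 i j im jm.
have nthE k (km : k < m) : nth x0 [seq f i | i <- enum 'I_m] k = f (Ordinal km).
  rewrite (nth_map (Ordinal km)) ?size_enum_ord //; congr f.
  exact: (nth_ord_enum _ (Ordinal km)).
by rewrite !nthE fE.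
Qed.

(** The starting singleton must contain [u], and [[set u]] is already stalled. *)
Lemma isolated_zf_size1 u : isolated u -> zf_size 1 -> #|G| = 1.
Proof.
move=> isou /existsP[S /andP[/cards1P[v ->] ZS]].
have /[!inE] /eqP uv : u \in [set v].
  by apply: contraTT ZS => /(isolated_failed isou).
subst v; suff -> : #|G| = #|[set u]| by rewrite cards1.
rewrite (zero_forcingP _ ZS [set u]) ?cardsT //; apply/stalledP => v w.
rewrite inE => /eqP-> vw; have := set11 w.
by rewrite -vw inE (isolatedE w isou).
Qed.

(** A proper stalled superset misses one or two vertices [a], [b]; stalledness becomes a condition
    on their positions in [s], which four or more positions contradict. *)
Lemma path_failed_size s :
  (forall y, y \in s) -> induced_path s -> 1 < #|G| ->
  failed_size (#|G| - 2) -> #|G| <= 3.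
Proof.
move=> sT [s_uniq s_edge] G_gt1 /existsP[F /andP[/eqP cF]].
case/failedP => T [FT /stalledP stT nT].
have sG : size s = #|G|.
  by rewrite -(card_uniqP s_uniq); apply: eq_card => y; rewrite sT.
(* A single white vertex is covered by [a = b]. *)
have [a [b abT]] : exists a b, ~: T = [set a; b].
  have : 0 < #|~: T| by rewrite card_gt0 -setCT (inj_eq (@setC_inj _)).
  have : #|~: T| <= 2.
    by have := subset_leq_card FT; have := cardsC T; lia.
  rewrite leq_eqVlt => /predU1P[/eqP/cards2P[a [b [_ ->]]] _|T1 T0].
    by exists a, b.
  have /cards1P[a ->] : #|~: T| == 1 by lia.
  by exists a, a; rewrite setUid.
have TE y : (y \notin T) = (y == a) || (y == b) by rewrite -in_setC abT !inE.
pose adj i j := (i.+1 == j) || (j.+1 == i).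
have edgeE x y : edge x y = adj (index x s) (index y s).
  by rewrite -{1}(nth_index a (sT x)) -{1}(nth_index a (sT y)) s_edge ?index_mem.
(* A blue position sees both white positions or neither, and sees neither when they coincide. *)
have modT k : k < size s -> k != index a s -> k != index b s ->
    (adj k (index a s) = adj k (index b s)) /\ (a = b -> ~~ adj k (index a s)).
  move=> ks ka kb; have ik : index (nth a s k) s = k by rewrite index_uniq.
  have kT : nth a s k \in T.
    rewrite -[_ \in _]negbK TE negb_or.
    by rewrite (contraNneq _ ka) ?(contraNneq _ kb) // => <-; rewrite ik.
  have wN y : (y \in white_neighbors T (nth a s k)) =
      adj k (index y s) && ((y == a) || (y == b)).
    by rewrite inE TE edgeE ik.
  split; last first.
    move=> ab; apply/negP => ka1; apply: (stT _ a kT); apply/setP => y.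
    by rewrite wN inE -ab orbb andb_idl // => /eqP->.
  case ka1: (adj k (index a s)); case kb1: (adj k (index b s)) => //.
  - case: (stT _ a kT); apply/setP => y; rewrite wN inE.
    have [->|_] /= := eqVneq y a; first by rewrite ka1.
    by apply/andP => -[+ /eqP yb]; rewrite yb kb1.
  - case: (stT _ b kT); apply/setP => y; rewrite wN inE.
    have [->|_] /= := eqVneq y b; first by rewrite kb1 orbT.
    by rewrite orbF; apply/andP => -[+ /eqP yb]; rewrite yb ka1.
have aibi : index a s = index b s -> a = b.
  by move=> ab; rewrite -(nth_index a (sT a)) ab nth_index.
have ia : index a s < size s by rewrite index_mem.
have ib : index b s < size s by rewrite index_mem.
rewrite -sG leqNgt; apply/negP => s_gt3; move: (index a s) (index b s) ia ib aibi modT.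
have tri i j : i <= j -> j < size s -> (i = j -> a = b) ->
  (forall k, k < size s -> k != i -> k != j ->
     (adj k i = adj k j) /\ (a = b -> ~~ adj k i)) -> False.
  move=> ij js ab H; case: (eqVneq i j) => [eij|neij].
    have {}ab := ab eij; subst j.
    case: (posnP i) => i0.
      by have [||| _ /(_ ab)] := H 1; rewrite /adj; lia.
    by have [||| _ /(_ ab)] := H i.-1; rewrite /adj; lia.
  (* A position seeing exactly one of [i < j]: [i.-1] if [i > 0]; otherwise [j.+1] if [j <= 2],
     which exists since [size s > 3], and 1 if [j > 2]. *)
  case: (posnP i) => i0.
    have [j2|j2] := leqP j 2.
      by have [||| + _] := H j.+1; rewrite /adj; lia.
    by have [||| + _] := H i.+1; rewrite /adj; lia.
  by have [||| + _] := H i.-1; rewrite /adj; lia.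
move=> i j si sj ab H; have [ij|/ltnW ji] := leqP i j; first exact: (tri i j).
apply: (tri j i) => // [e|k ks kj ki]; first exact: ab.
have [Hk1 Hk2] := H k ks ki kj; split=> // e; rewrite -Hk1; exact: Hk2.
Qed.

End Forcing.

(** * Isomorphism types as vertex lists *)

(** Links isomorphism with the lists that forcing chains produce; [x] is the default for [nth]. *)
Lemma path_isoP (G : sgraph) (x : G) (m : nat) :
  graph_iso (path_graph m) G <->
  exists2 s : seq G, (forall y, y \in s) /\ size s = m & induced_path s.
Proof.
split=> [[f [g fK gK] fE]|[s [sT <-] [s_uniq s_edge]]].
  exists [seq f i | i <- enum 'I_m]; last exact: induced_path_map (can_inj fK) fE.
  split; last by rewrite size_map size_enum_ord.
  by move=> y; rewrite -(gK y) map_f ?mem_enum.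
apply: (graph_iso_inj (f := fun i : path_graph _ => nth x s i)).
- by move=> i j /eqP; rewrite nth_uniq // => /eqP/val_inj.
- rewrite card_ord -(card_uniqP s_uniq); apply/subset_leq_card/subsetP => y _.
  exact: sT.
- by move=> i j; rewrite s_edge.
Qed.

Lemma path_union_isoP (G : sgraph) (m : nat) :
  graph_iso (disjoint_union (path_graph m) (complete_graph 1)) G <->
  exists u (s : seq G),
    [/\ isolated u, s =i ~: [set u], size s = m & induced_path s].
Proof.
split=> [[f [g fK gK] fE]|[u [s [isou sE <- [s_uniq s_edge]]]]].
  have f_inj := can_inj fK.
  exists (f (inr ord0)), [seq f (inl i) | i <- enum 'I_m]; split.
  - apply/forallP => y; rewrite -(gK y) fE; case: (g y) => [//|i].
    by rewrite [i]ord1 edge_irrefl.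
  - move=> y; rewrite !inE -(gK y) (inj_eq f_inj); case: (g y) => [i|i].
      by rewrite (map_f (fun i => f (inl i))) ?mem_enum.
    by rewrite [i]ord1 eqxx; apply/mapP => -[j _ /f_inj].
  - by rewrite size_map size_enum_ord.
  - apply: (@induced_path_map _ _ (fun i => f (inl i))).
      by move=> i j /f_inj[].
    by move=> i j; rewrite fE.
have us : u \notin s by rewrite sE !inE eqxx.
pose f (z : disjoint_union (path_graph (size s)) (complete_graph 1)) : G :=
  match z with inl i => nth u s i | inr _ => u end.
apply: (graph_iso_inj (f := f)).
- move=> [i|i] [j|j] /= e.
  + by move/eqP: e; rewrite nth_uniq // => /eqP/val_inj->.
  + by move: us; rewrite -e mem_nth.
  + by move: us; rewrite e mem_nth.
  + by rewrite [i]ord1 [j]ord1.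
- rewrite card_sum !card_ord -(card_uniqP s_uniq) (eq_card sE).
  by rewrite -(cardsC [set u]) cards1 addnC.
- move=> [i|i] [j|j] /=; first by rewrite s_edge.
  + by rewrite (isolatedE _ isou).
  + by rewrite (isolatedE _ isou).
  + by rewrite [i]ord1 [j]ord1 !edge_irrefl.
Qed.

(** * The extremal graphs *)

(** Integers avoid truncated subtraction at [n = 1]. [K_2] is set apart because its span is
    [0 = n - 2], and [1 < n] excludes [K_1], whose span 0 differs from -1. *)
Theorem theorem14 (G : sgraph) (n : nat) (n_gt0 : (0 < n)%N)
    (order_G : #|G| = n) :
  ((zf_span G)%:Z = n%:Z - 1 <-> graph_iso G (complete_graph 1)) /\
  (~ graph_iso G (complete_graph 2) ->
   ((zf_span G)%:Z = n%:Z - 2 <->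
    ((1 < n)%N /\
     graph_iso G (disjoint_union (path_graph n.-1) (complete_graph 1))) \/
    graph_iso G (path_graph 3))).
Proof.
subst n; have [z [f [/andP[z_gt0 z_le] f_lt spanE zE fE]]] := zf_spanE n_gt0.
have isolated_f : f = #|G|.-1 -> exists u : G, isolated u.
  by move=> ef; apply: failed_size_isolated; rewrite // fE ef.
have f_isolated (u : G) : isolated u -> f = #|G|.-1.
  move=> isou; suff : failed_size G #|G|.-1 by rewrite fE; lia.
  apply/existsP; exists (~: [set u]); rewrite cardsC1 eqxx.
  by rewrite (isolated_failed isou) // !inE eqxx.
have [x] : exists x : G, true by have /card_gt0P[x _] := n_gt0; exists x.
move=> _; split; [split=> [span|G1]|move=> nK2; split=> [span|]].
- have [z1 fn] : z = 1%N /\ f = #|G|.-1 by lia.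
  have [u isou] := isolated_f fn.
  have G1 : #|G| = 1%N.
    by apply: (isolated_zf_size1 isou); rewrite zE z1 n_gt0.
  have all_u y : y = u.
    by have /eqP/fintype1P[v vE] := G1; rewrite (vE y) (vE u).
  apply: (graph_iso_inj (f := fun=> ord0 : complete_graph 1)).
  + by move=> a b _; rewrite (all_u a) (all_u b).
  + by rewrite card_ord G1.
  + by move=> a b; rewrite (all_u a) (all_u b) !edge_irrefl.
- by move/graph_iso_card: G1; rewrite card_ord; lia.
- have [[z1 fn]|[z2 fn]] : z = 1%N /\ f.+2 = #|G| \/ z = 2 /\ f = #|G|.-1 by lia.
    have : zf_size G 1 by rewrite zE z1 n_gt0.
    case/existsP => S /andP[/cards1P[v ->]]; rewrite -(setU0 [set v]) => Zv.
    have [||s sE sP] := zero_forcing_path _ _ Zv; rewrite ?inE //.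
      by move=> u; rewrite inE.
    have sT y : y \in s by rewrite sE !inE.
    have sG : size s = #|G|.
      by rewrite -(card_uniqP sP.1); apply: eq_card => y; rewrite sT.
    have isoP : graph_iso G (path_graph #|G|).
      by apply/graph_iso_sym/(path_isoP x); exists s.
    have G_gt1 : (1 < #|G|)%N by lia.
    have := path_failed_size sT sP G_gt1; rewrite fE -fn subn2 /= => /(_ (leqnn _)) G3.
    (* The path has [f + 2 <= 3] vertices: [f = 1] gives [P_3], while [f = 0] gives the excluded
       [K_2]. *)
    right; case: (eqVneq f 1%N) => [f1|f1]; first by rewrite -fn f1 in isoP.
    case: nK2; have f0 : f = 0%N by lia.
    move: isoP; rewrite -fn f0 => -[h h_bij hE]; exists h => // a b.
    rewrite -hE; case: (h a) (h b) => [[|[|?]] ?] [[|[|?]] ?] //.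
  left; have G_gt1 : (1 < #|G|)%N by lia.
  split=> //; have [u isou] := isolated_f fn.
  have : zf_size G 2 by rewrite zE z2.
  case/existsP => S /andP[/eqP S2 ZS].
  (* The isolated [u] is one of the two starting vertices, so the other one forces the rest. *)
  have uS : u \in S by apply: contraTT ZS => /(isolated_failed isou).
  have /cards1P[v Sv] : #|S :\ u| == 1%N by move: (cardsD1 u S); rewrite uS S2; lia.
  have vu : v \notin [set u].
    by have := set11 v; rewrite -Sv !inE => /andP[].
  have isoU y : y \in [set u] -> isolated y by rewrite inE => /eqP->.
  have [|s sE sP] := zero_forcing_path isoU vu; first by rewrite setUC -Sv setD1K.
  apply/graph_iso_sym/path_union_isoP; exists u, s; split=> //.
  by rewrite -(card_uniqP sP.1) (eq_card sE) cardsC1.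
- case=> [[G_gt1 /graph_iso_sym/path_union_isoP[u [s [isou sE sG sP]]]]|isoP3].
    have fn := f_isolated u isou.
    suff z2 : z = 2 by lia.
    suff: zf_size G 2 && ~~ zf_size G 1 by rewrite !zE; lia.
    apply/andP; split; last by apply/negP => /(isolated_zf_size1 isou); lia.
    have isoU y : y \in [set u] -> isolated y by rewrite inE => /eqP->.
    have s_gt0 : (0 < size s)%N by rewrite sG; lia.
    apply/existsP; exists (nth x s 0 |: [set u]).
    rewrite (path_zero_forcing x isoU sE sP) // cards2.
    by have := mem_nth x s_gt0; rewrite sE !inE => ->.
  have G3 : #|G| = 3 by rewrite (graph_iso_card isoP3) card_ord.
  have /(path_isoP x)[s [sT s3] sP] := graph_iso_sym isoP3.
  have [s_uniq s_edge] := sP.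
  suff [z1 f1] : z = 1%N /\ f = 1%N by lia.
  have : zf_size G 1.
    have s_gt0 : (0 < size s)%N by rewrite s3.
    apply/existsP; exists (nth x s 0 |: set0); rewrite (path_zero_forcing x _ _ sP) //.
    + by rewrite setU0 cards1.
    + by move=> u; rewrite inE.
    + by move=> y; rewrite sT !inE.
  have : failed_size G 1.
    (* The middle vertex of [P_3] has two white neighbors, so alone it is stalled. *)
    apply/existsP; exists [set nth x s 1]; rewrite cards1 eqxx /=.
    apply/failedP; exists [set nth x s 1]; split=> //; last first.
      apply/eqP => /(congr1 (fun A : {set G} => #|A|)).
      by rewrite cards1 cardsT G3.
    apply/stalledP => v w; rewrite inE => /eqP-> sw.
    have sw_mem k : (k < 3)%N -> k != 1%N -> nth x s k = w.
      move=> k3 k1; apply/set1P; rewrite -sw !inE s_edge ?s3 // nth_uniq ?s3 //.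
      by lia.
    have /eqP : nth x s 0 = nth x s 2 by rewrite !sw_mem.
    by rewrite nth_uniq ?s3.
  have : f <> 2.
    move=> f2; have [|u isou] := isolated_f; first by rewrite G3.
    have us : (index u s < 3)%N by rewrite -s3 index_mem.
    have nb k : (k < 3)%N -> ((index u s).+1 == k) || (k.+1 == index u s) = false.
      move=> k3; rewrite -(s_edge x) ?s3 // nth_index ?sT //.
      by rewrite (isolatedE _ isou).
    (* Every position in [P_3] is adjacent to position 0 or 1. *)
    by have := nb 0%N isT; have := nb 1%N isT; lia.
  by rewrite zE fE G3; lia.
Qed.
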